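(* The constrained minimizers of the RLHF loss with optimal reward and of the DPO loss need not coincide: there exist a prompt distribution $\mathcal D_x$, a reference policy $\pi_{\rm ref}$, a Bradley–Terry preference distribution $p^*$ with latent reward $r^*$, a parameter $\lambda>0$, and a constraint set $\mathcal S_\pi$ of policies such that $$\arg\min_{\pi_\theta\in\mathcal S_\pi}\ell_{\rm RLHF}(\pi_\theta,\pi_{\rm ref},r^*,\lambda)\ \neq\ \arg\min_{\pi_\theta\in\mathcal S_\pi}\ell_{\rm DPO}(\pi_\theta,\pi_{\rm ref},\lambda).$$
   Context: A policy $\pi(y|x)$ is a conditional probability distribution over responses $y$ given a prompt $x$; a constraint set $\mathcal S_\pi$ is a set of policies. Bradley–Terry: $p^*(y_1\succ y_2|x)=\frac{\exp r^*(y_1,x)}{\exp r^*(y_1,x)+\exp r^*(y_2,x)}$. Data: $\{y_w,y_l,x\}\sim\mathcal D_{tr}$ means $x\sim\mathcal D_x$; $y_1,y_2$ drawn from $\pi_{\rm ref}(\cdot|x)$ (the case $y_1=y_2$ is either excluded or assigned preference $1/2$, which only adds constants to the DPO loss); $z\in\{0,1\}$ with $\Pr(z=1)=p^*(y_1\succ y_2|x)$; $(y_w,y_l)=(y_1,y_2)$ if $z=1$, else $(y_2,y_1)$. Losses (with $\sigma(t)=1/(1+e^{-t})$): $$\ell_{\rm RLHF}(\pi_\theta,\pi_{\rm ref},r,\lambda)=\mathbb E_{x\sim\mathcal D_x,\,y\sim\pi_\theta(y|x)}[-r(y,x)]+\lambda\,\mathbb E_{x\sim\mathcal D_x}\big[\mathrm{KL}[\pi_\theta(y|x)\,\|\,\pi_{\rm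 ref}(y|x)]\big],$$ $$\ell_{\rm DPO}(\pi_\theta,\pi_{\rm ref},\lambda)=\mathbb E_{\{y_w,y_l,x\}\sim\mathcal D_{tr}}\left[-\log\sigma\!\left(\lambda\log\frac{\pi_\theta(y_w|x)}{\pi_{\rm ref}(y_w|x)}-\lambda\log\frac{\pi_\theta(y_l|x)}{\pi_{\rm ref}(y_l|x)}\right)\right].$$ *)

(* Defs.v *)
From HB Require Import structures.
From mathcomp Require Import all_boot all_order all_algebra.
From mathcomp Require Import boolp classical_sets reals sequences exp.

Set Implicit Arguments.
Unset Strict Implicit.
Unset Printing Implicit Defensive.

Import Order.TTheory GRing.Theory Num.Theory.
Local Open Scope classical_set_scope.
Local Open Scope ring_scope.

Definition is_pmf (R : realType) (T : finType) (P : T -> R) : Prop :=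
  (forall t, 0 <= P t) /\ \sum_t P t = 1.

Definition expect (R : realType) (T : finType) (P : T -> R) (f : T -> R) : R :=
  \sum_t P t * f t.

(* [pi x y] stands for the conditional probability pi(y | x). *)
Definition is_policy (R : realType) (X Y : finType) (pi : X -> Y -> R) : Prop :=
  forall x, is_pmf (pi x).

(* When the supports agree, every logarithm of a ratio of policies below that
   carries a nonzero weight has a positive argument, so the convention
   [ln 0 = 0] never contributes to a loss. *)
Definition same_support (R : realType) (X Y : finType)
    (pi pi' : X -> Y -> R) : Prop :=
  forall x y, (0 < pi x y) <-> (0 < pi' x y).

Definition sigmoid (R : realType) (t : R) : R := 1 / (1 + expR (- t)).

(* [p x y1 y2] stands for p(y1 > y2 | x), and [r x y] for r(y, x). *)
Definition bradley_terry (R : realType) (X Y : finType)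
    (r : X -> Y -> R) (p : X -> Y -> Y -> R) : Prop :=
  forall x y1 y2,
    p x y1 y2 = expR (r x y1) / (expR (r x y1) + expR (r x y2)).

Definition KL (R : realType) (T : finType) (P Q : T -> R) : R :=
  \sum_t P t * ln (P t / Q t).

Definition loss_RLHF (R : realType) (X Y : finType) (Dx : X -> R)
    (pi pi_ref : X -> Y -> R) (r : X -> Y -> R) (lambda : R) : R :=
  expect Dx (fun x => expect (pi x) (fun y => - r x y))
  + lambda * expect Dx (fun x => KL (pi x) (pi_ref x)).

(* Joint law of (x, y1, y2, z). The draws y1 and y2 are independent and may
   coincide, in which case a Bradley-Terry preference equals 1/2. *)
Definition raw_law (R : realType) (X Y : finType) (Dx : X -> R)
    (pi_ref : X -> Y -> R) (p : X -> Y -> Y -> R)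
    (s : X * Y * Y * bool) : R :=
  let: (x, y1, y2, z) := s in
  Dx x * pi_ref x y1 * pi_ref x y2
  * (if z then p x y1 y2 else 1 - p x y1 y2).

Definition label (X Y : finType) (s : X * Y * Y * bool) : Y * Y * X :=
  let: (x, y1, y2, z) := s in if z then (y1, y2, x) else (y2, y1, x).

(* Law of (y_w, y_l, x): the pushforward of [raw_law] under [label]. *)
Definition Dtr (R : realType) (X Y : finType) (Dx : X -> R)
    (pi_ref : X -> Y -> R) (p : X -> Y -> Y -> R) (t : Y * Y * X) : R :=
  \sum_(s | label s == t) raw_law Dx pi_ref p s.

Definition loss_DPO (R : realType) (X Y : finType) (D : Y * Y * X -> R)
    (pi pi_ref : X -> Y -> R) (lambda : R) : R :=
  expect D (fun t => let: (yw, yl, x) := t in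
    - ln (sigmoid (lambda * ln (pi x yw / pi_ref x yw)
                   - lambda * ln (pi x yl / pi_ref x yl)))).

Definition argmin (R : realType) (T : Type) (S : set T) (f : T -> R) : set T :=
  [set a | S a /\ forall b, S b -> f a <= f b].

(* Main.v *)
(** With a constant reward every preference is a fair coin, so [Dtr] is symmetric
    in the two responses and the DPO loss cannot tell a policy [pi] from its
    geometric reflection [pi'] through the reference ([pi * pi'] proportional to
    [pi_ref ^ 2]), which negates every difference of log-ratios. The RLHF loss is
    then [lambda * KL], which is not invariant under this reflection unless
    [pi_ref] is uniform: for [pi_ref = (2/3, 1/3)], [pi = (4/5, 1/5)] and
    [pi' = (1/2, 1/2)] the two divergences differ. So both policies of
    [S = {pi, pi'}] minimize the DPO loss, and only one minimizes the RLHF loss. *)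

Require Import Defs.
From mathcomp Require Import all_boot all_order all_algebra.
From mathcomp Require Import boolp classical_sets reals sequences exp.
From mathcomp Require Import ring lra.

Set Implicit Arguments.
Unset Strict Implicit.
Unset Printing Implicit Defensive.

Import Order.TTheory GRing.Theory Num.Theory.
Local Open Scope classical_set_scope.
Local Open Scope ring_scope.

(** A tie under [g] makes both points minimizers of [g]. If both also minimized [f], the two
    inequalities would force [f a = f b]. *)
Lemma argmin_pair_neq (R : realType) (T : Type) (a b : T) (f g : T -> R) :
  g a = g b -> f a <> f b -> argmin [set a; b] f <> argmin [set a; b] g.
Proof.
move=> gab fab eq_fg.
have ga : argmin [set a; b] g a.
  by split; [left | move=> _ [->|->] //; rewrite gab].
have gb : argmin [set a; b] g b.
  by split; [right | move=> _ [->|->] //; rewrite gab].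
move: ga gb; rewrite -eq_fg => -[_ fa] [_ fb].
by apply: fab; apply/eqP; rewrite eq_le fa ?fb //; [left | right].
Qed.

(** Flipping the coin [z] is a bijection of the raw samples that exchanges winner and loser; for a
    fair coin it preserves their weights. *)
Lemma Dtr_swap (R : realType) (X Y : finType) (Dx : X -> R)
    (pi_ref : X -> Y -> R) (p : X -> Y -> Y -> R) :
  (forall x y1 y2, p x y1 y2 = 1 - p x y1 y2) ->
  forall yw yl x, Dtr Dx pi_ref p (yw, yl, x) = Dtr Dx pi_ref p (yl, yw, x).
Proof.
move=> p_half yw yl x; rewrite /Dtr.
pose flip (s : X * Y * Y * bool) := (s.1, ~~ s.2).
have flipK : involutive flip by case=> s z; rewrite /flip /= negbK.
rewrite (reindex_inj (inv_inj flipK)); apply: eq_big => -[[[x' y1] y2] []] /=.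
- by rewrite !xpair_eqE andbC [in RHS]andbC [(y2 == _) && _]andbC.
- by rewrite !xpair_eqE andbC [in RHS]andbC [(y1 == _) && _]andbC.
- by rewrite -p_half.
- by rewrite -p_half.
Qed.

Lemma loss_DPO_reflect (R : realType) (X Y : finType) (D : Y * Y * X -> R)
    (pi pi' pi_ref : X -> Y -> R) (lambda : R) (c : X -> R) :
  (forall yw yl x, D (yw, yl, x) = D (yl, yw, x)) ->
  (forall x y, 0 < pi x y) -> (forall x y, 0 < pi' x y) ->
  (forall x y, 0 < pi_ref x y) ->
  (forall x y, pi x y * pi' x y = c x * pi_ref x y ^+ 2) ->
  loss_DPO D pi pi_ref lambda = loss_DPO D pi' pi_ref lambda.
Proof.
move=> D_sym pi0 pi'0 ref0 prod_c; rewrite /loss_DPO /expect.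
pose swap (t : Y * Y * X) := let: (y1, y2, x) := t in (y2, y1, x).
have swapK : involutive swap by case=> [[]].
rewrite (reindex_inj (inv_inj swapK)); apply: eq_bigr => -[[yw yl] x] _ /=.
rewrite D_sym; congr (_ * - ln (sigmoid _)).
(* The right-hand side does not depend on [y], so it cancels between [yw] and [yl]: the log-ratio
   differences of [pi] and [pi'] are opposite. *)
have lnD y : ln (pi x y / pi_ref x y) + ln (pi' x y / pi_ref x y) = ln (c x).
  rewrite -lnM ?posrE ?divr_gt0 //; congr ln.
  rewrite mulrACA prod_c -invfM -expr2 mulfK //.
  by rewrite expf_neq0 // gt_eqF.
by rewrite -!mulrBr; congr (_ * _); have := lnD yw; have := lnD yl; lra.
Qed.

Lemma sum_unit (R : nmodType) (F : unit -> R) : \sum_x F x = F tt.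
Proof. by rewrite (bigD1 tt) //= big1 ?addr0 //; case. Qed.

Lemma loss_RLHF_unit_reward0 (R : realType) (Y : finType)
    (pi pi_ref : unit -> Y -> R) :
  loss_RLHF (fun=> 1) pi pi_ref (fun _ _ => 0) 1 = KL (pi tt) (pi_ref tt).
Proof.
rewrite /loss_RLHF /expect !sum_unit.
by rewrite big1 ?mulr0 ?add0r ?mul1r // => y _; rewrite oppr0 mulr0.
Qed.

Definition bernoulli_policy (R : realType) (t : R) (_ : unit) (y : bool) : R :=
  if y then t else 1 - t.

Lemma bernoulli_policy_gt0 (R : realType) (t : R) x y :
  0 < t < 1 -> 0 < bernoulli_policy t x y.
Proof. by case: y => /andP[t0 t1] /=; rewrite ?subr_gt0. Qed.

Lemma is_policy_bernoulli (R : realType) (t : R) :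
  0 < t < 1 -> is_policy (bernoulli_policy t).
Proof.
move=> t01 x; split=> [y|]; first exact/ltW/bernoulli_policy_gt0.
by rewrite big_bool /= addrC subrK.
Qed.

Lemma KL_bernoulli_reflect_lt (R : realType) :
  KL (bernoulli_policy (4 / 5 : R) tt) (bernoulli_policy (2 / 3) tt)
  < KL (bernoulli_policy (1 / 2 : R) tt) (bernoulli_policy (2 / 3) tt).
Proof.
rewrite /KL !big_bool /=.
have -> : 4 / 5 / (2 / 3) = 6 / 5 :> R by field.
have -> : (1 - 4 / 5) / (1 - 2 / 3) = 3 / 5 :> R by field.
have -> : 1 / 2 / (2 / 3) = 3 / 4 :> R by field.
have -> : (1 - 1 / 2) / (1 - 2 / 3) = 3 / 2 :> R by field.
(* Five times the claim is [ln ((6/5)^4 (3/5)) < 5/2 ln (9/8)]; the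
   exponent 5/2 can be lowered to 2. *)
have lt_sq : ln ((6 / 5) ^+ 4 * (3 / 5)) < ln ((3 / 4 * (3 / 2)) ^+ 2) :> R.
  by rewrite ltr_ln ?posrE; lra.
(* This sign is what permits lowering the exponent: [2 ln (9/8) < 5/2 ln (9/8)]. *)
have ln98_gt0 : 0 < ln (3 / 4 * (3 / 2)) :> R by apply: ln_gt0; lra.
have ln98 : ln (3 / 4 * (3 / 2)) = ln (3 / 4) + ln (3 / 2) :> R.
  by rewrite lnM ?posrE; lra.
have [p65 p35 p98] :
    [/\ 0 < 6 / 5 :> R, 0 < 3 / 5 :> R & 0 < 3 / 4 * (3 / 2) :> R].
  by split; lra.
by move: lt_sq; rewrite lnM ?posrE ?exprn_gt0 // !lnXn //; lra.
Qed.

Theorem theorem3 (R : realType) :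
  exists (X Y : finType) (Dx : X -> R) (pi_ref : X -> Y -> R)
         (rstar : X -> Y -> R) (pstar : X -> Y -> Y -> R) (lambda : R)
         (S : set (X -> Y -> R)),
    [/\ is_pmf Dx, is_policy pi_ref, bradley_terry rstar pstar & 0 < lambda] /\
    (forall pi, S pi -> is_policy pi /\ same_support pi pi_ref) /\
    argmin S (fun pi => loss_RLHF Dx pi pi_ref rstar lambda)
      <> argmin S (fun pi => loss_DPO (Dtr Dx pi_ref pstar) pi pi_ref lambda).
Proof.
have ref01 : 0 < (2 / 3 : R) < 1 by lra.
have a01 : 0 < (4 / 5 : R) < 1 by lra.
have b01 : 0 < (1 / 2 : R) < 1 by lra.
exists unit, bool, (fun=> 1), (bernoulli_policy (2 / 3)), (fun _ _ => 0),
  (fun _ _ _ => 1 / 2), 1,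
  [set bernoulli_policy (4 / 5); bernoulli_policy (1 / 2)].
split; first split=> //.
- by split=> //; rewrite sum_unit.
- exact: is_policy_bernoulli.
(* What remains is [1 / 2 = 1 / (1 + 1)], true by computation. *)
- by move=> x y1 y2; rewrite expR0.
split.
  by move=> _ [->|->]; split; try exact: is_policy_bernoulli;
    move=> x y; split=> _; exact: bernoulli_policy_gt0.
apply: argmin_pair_neq.
  (* The constant solves both [4/5 * 1/2 = c * (2/3)^2] and [1/5 * 1/2 = c * (1/3)^2]. *)
  apply: (@loss_DPO_reflect _ _ _ _ _ _ _ _ (fun=> 9 / 10));
    try by move=> x y; exact: bernoulli_policy_gt0.
    by apply: Dtr_swap => x y1 y2; lra.
  by move=> x []; rewrite /bernoulli_policy; field.
rewrite !loss_RLHF_unit_reward0; apply/eqP.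
by rewrite lt_eqF // KL_bernoulli_reflect_lt.
Qed.
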